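(* Let $G=(L+R,E)$ be a bipartite graph with vertex bipartition $L,R$. The following statements are equivalent: (i) Every balanced assignment $w:L\cup R\to\mathbb{N}_0$ is positively equatable in $G$. (ii) For every nonempty set of vertices $X$ that is properly contained in $L$ or properly contained in $R$, one has $|X|<|N(X)|$, where $N(X)$ is the set of vertices of $G$ adjacent to some vertex of $X$.
   Context: An assignment $w:L\cup R\to\mathbb{N}_0$ is balanced if $w(L)=w(R)$, where $w(U)=\sum_{v\in U}w(v)$. For an edge $e=\{u,v\}$, a positive step on $e$ increases each of $w(u)$ and $w(v)$ by $1$. The assignment $w$ is positively equatable in $G$ if some finite sequence of positive steps makes all vertex weights equal.
   Formalization: Both L and R are assumed nonempty; for L empty and |R| at least 2 the equivalence fails, since only w=0 is balanced, so (i) holds, while a single vertex X of R has no neighbours, so (ii) fails. *)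

(* Defs.v *)
From HB Require Import structures.
From mathcomp Require Import all_boot.

Set Implicit Arguments.
Unset Strict Implicit.
Unset Printing Implicit Defensive.

(* A finite simple graph is a symmetric irreflexive [e : rel T] on a finType. *)
Section Defs.
Variables (T : finType) (e : rel T).

(* [partition] requires its blocks to be nonempty; [L != R] rules out the
   collapse of [[set L; R]] to a single block. *)
Definition bipartition (L R : {set T}) : Prop :=
  [/\ L != R,
      partition [set L; R] [set: T] &
      forall u v, e u v -> u \in L /\ v \in R \/ u \in R /\ v \in L].

Definition weight (w : T -> nat) (U : {set T}) : nat := \sum_(v in U) w v.

Definition balanced (L R : {set T}) (w : T -> nat) : Prop :=
  weight w L = weight w R.

Definition positive_step (w : T -> nat) (d : T * T) : T -> nat :=
  fun x => if x \in [set d.1; d.2] then (w x).+1 else w x.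

Definition positively_equatable (w : T -> nat) : Prop :=
  exists s : seq (T * T),
    all (fun d => e d.1 d.2) s /\
    forall x y, foldl positive_step w s x = foldl positive_step w s y.

Definition neighbours (X : {set T}) : {set T} :=
  [set v | [exists u in X, e u v]].

End Defs.

(* Main.v *)
Require Import Defs.
From mathcomp Require Import all_boot.
From mathcomp Require Import zify.

(** Positive steps realise the equalisation of [w] at level [c] exactly when
    the demand [c - w] is a sum of edge indicators. For one direction, the edges
    counted in such a sum give [N(X)] at least the demand of [X]; if
    [|N(X)| <= |X|], this fails for the assignment that is zero except for one
    unit on a vertex of [N(X)] (on any vertex facing [X] if [N(X)] is empty) and
    one on the side of [X] but outside it.
    For the other direction, strict expansion makes the demand satisfy Hall's
    condition once [c] is at least the total weight [w(L)], and the weighted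
    version of Hall's theorem provides the edges. *)

Set Implicit Arguments.
Unset Strict Implicit.
Unset Printing Implicit Defensive.

(** * Arithmetic of weights *)

Section Weight.
Variable T : finType.
Implicit Types (w b f g : T -> nat) (U V : {set T}).

Lemma eq_weight f g U : f =1 g -> weight f U = weight g U.
Proof. by move=> fg; apply: eq_bigr => v _. Qed.

Lemma weightD f g U : weight (fun v => f v + g v) U = weight f U + weight g U.
Proof. exact: big_split. Qed.

Lemma weight_pred1 (x : T) U : weight (fun v => (v == x) : nat) U = (x \in U).
Proof.
rewrite /weight; case: (boolP (x \in U)) => xU.
  rewrite (bigD1 x) //= eqxx big1 // => v /andP[_ /negbTE ->] //.
by apply: big1 => v vU; case: eqP => // vx; rewrite -vx vU in xU.
Qed.

Lemma weight_pair (x y : T) U : x != y ->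
  weight (fun v => (v \in [set x; y]) : nat) U = (x \in U) + (y \in U).
Proof.
move=> xy; rewrite -!weight_pred1 -weightD; apply: eq_weight => v.
rewrite !inE; case: (eqVneq v x) => [->|_] //=.
by rewrite (negbTE xy).
Qed.

Lemma weight_const c U : weight (fun=> c) U = c * #|U|.
Proof. by rewrite /weight sum_nat_const mulnC. Qed.

Lemma weight_sub w c U : (forall v, w v <= c) ->
  weight (fun v => c - w v) U + weight w U = c * #|U|.
Proof.
move=> wc; rewrite -weightD -weight_const.
by apply: eq_weight => v; rewrite subnK.
Qed.

Lemma weight_subset w U V : U \subset V -> weight w U <= weight w V.
Proof.
move=> UV; rewrite /weight [leqRHS](big_setID U) /= (setIidPr UV).
exact: leq_addr.
Qed.

Lemma weight_restrict w U V :
  weight (fun v => if v \in V then w v else 0) U = weight w (U :&: V).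
Proof.
rewrite /weight -big_mkcondr; apply: eq_bigl => v; by rewrite inE.
Qed.

Lemma weightID w U V : weight w U = weight w (U :&: V) + weight w (U :\: V).
Proof. exact: big_setID. Qed.

Lemma weight_set1 w (x : T) : weight w [set x] = w x.
Proof. exact: big_set1. Qed.

Lemma leq_weight w (v : T) U : v \in U -> w v <= weight w U.
Proof. by move=> vU; rewrite -weight_set1 weight_subset ?sub1set. Qed.

Lemma weight_gt0P w U : 0 < weight w U -> exists2 v, v \in U & 0 < w v.
Proof.
rewrite lt0n sum_nat_eq0 => /forall_inPn[v vU]; rewrite -lt0n => wv.
by exists v.
Qed.

End Weight.

(** * Edge sequences and their degrees *)

Section Degree.
Variables (T : finType) (e : rel T).
Hypotheses (e_sym : symmetric e) (e_irr : irreflexive e).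

Definition degree (s : seq (T * T)) (v : T) : nat :=
  count (fun d => v \in [set d.1; d.2]) s.

(** Each step adds an amount independent of the current weights, so equatability depends on [s] only
    through its degrees. *)
Lemma foldl_positive_step (w : T -> nat) s v :
  foldl (@positive_step T) w s v = w v + degree s v.
Proof.
elim: s w => [|d s IHs] w /=; first by rewrite addn0.
by rewrite IHs /positive_step; case: ifP => _; rewrite ?addSnnS.
Qed.

Lemma neighboursP (X : {set T}) v :
  reflect (exists2 u, u \in X & e u v) (v \in neighbours e X).
Proof. by rewrite inE; apply: exists_inP. Qed.

Lemma neighboursS (X Y : {set T}) :
  X \subset Y -> neighbours e X \subset neighbours e Y.
Proof.
move=> /subsetP XY; apply/subsetP => v /neighboursP[u /XY uY euv].
by apply/neighboursP; exists u.
Qed.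

Lemma neighboursU (X Y : {set T}) :
  neighbours e (X :|: Y) = neighbours e X :|: neighbours e Y.
Proof.
apply/eqP; rewrite eqEsubset subUset !neighboursS ?subsetUl ?subsetUr // !andbT.
apply/subsetP => v /neighboursP[u uXY euv]; rewrite inE.
by move: uXY; rewrite inE => /orP[uX|uY]; apply/orP; [left|right];
  apply/neighboursP; exists u.
Qed.

(** Each end of an edge that lies in [X] is charged to the opposite end, which lies in [N(X)]. *)
Lemma weight_degree_neighbours (s : seq (T * T)) (X : {set T}) :
  all (fun d => e d.1 d.2) s ->
  weight (degree s) X <= weight (degree s) (neighbours e X).
Proof.
elim: s => [|[u v] s IHs] /=; first by rewrite /weight !big1.
case/andP=> euv /IHs {}IHs.
have uv : u != v by apply: contraTneq euv => ->; rewrite e_irr.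
rewrite !(weightD (fun z => (z \in [set u; v]) : nat)) !weight_pair //.
apply: leq_add => //; rewrite [leqRHS]addnC; apply: leq_add.
- case: (boolP (u \in X)) => // uX.
  by have -> : v \in neighbours e X by apply/neighboursP; exists u.
- case: (boolP (v \in X)) => // vX.
  by have -> : u \in neighbours e X by apply/neighboursP; exists v; rewrite // e_sym.
Qed.

End Degree.

(** * Weighted Hall theorem and the two implications *)

Section Bipartite.
Variables (T : finType) (e : rel T).
Implicit Types L R X : {set T}.

Lemma bipartitionC L R : bipartition e L R -> bipartition e R L.
Proof.
case=> LR part eLR; split; [by rewrite eq_sym | by rewrite setUC |].
by move=> u v /eLR; tauto.
Qed.

Lemma bipartition_setU L R : bipartition e L R -> L :|: R = [set: T].
Proof.
case=> LR /and3P[/eqP cov _ _] _; rewrite -cov /cover.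
by rewrite big_setU1 ?inE // big_set1.
Qed.

Lemma bipartition_disjoint L R : bipartition e L R -> [disjoint L & R].
Proof.
case=> LR /and3P[_ /trivIsetP triv _] _.
by apply: triv => //; rewrite !inE eqxx ?orbT.
Qed.

Lemma bipartition_neq0 L R : bipartition e L R -> L != set0.
Proof.
case=> _ /and3P[_ _]; rewrite !inE negb_or eq_sym => /andP[] //.
Qed.

Lemma bipartition_notin L R v : bipartition e L R -> v \in L -> v \notin R.
Proof. by move=> /bipartition_disjoint dLR vL; rewrite (disjointFr dLR vL). Qed.

Lemma bipartition_neighbours L R X :
  bipartition e L R -> X \subset L -> neighbours e X \subset R.
Proof.
move=> LR /subsetP XL; apply/subsetP => v /neighboursP[u /XL uL euv].
have uR := bipartition_notin LR uL.
by case: LR => _ _ /(_ _ _ euv) [[]|[]] //; rewrite (negbTE uR).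
Qed.

(* Halmos-Vaughan: pick an edge with positive demand at both ends. Either
   Hall's condition survives its removal, or there is a tight set separating
   its ends, along which the demand splits. *)
Lemma weighted_hall L R (b : T -> nat) :
  bipartition e L R -> weight b L = weight b R ->
  (forall X, X \subset L -> weight b X <= weight b (neighbours e X)) ->
  exists2 s, all (fun d => e d.1 d.2) s & degree s =1 b.
Proof.
move=> LR; have [n] := ubnP (weight b L).
elim: n b => // n IHn b ltbn bLR hall.
have [bL0|bL_gt0] := posnP (weight b L).
  exists [::] => // v; symmetry; apply/eqP; rewrite -leqn0.
  have : v \in L :|: R by rewrite (bipartition_setU LR) inE.
  by rewrite inE => /orP[] /(leq_weight b); rewrite -?bLR bL0.
have [x xL bx] := weight_gt0P bL_gt0.
have [y yNx by_] : exists2 y, y \in neighbours e [set x] & 0 < b y.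
  apply: weight_gt0P; apply: leq_trans (hall _ _); last by rewrite sub1set.
  by rewrite weight_set1.
have exy : e x y by case/neighboursP: yNx => u /set1P ->.
have yR : y \in R.
  by apply: (subsetP (bipartition_neighbours LR _)) yNx; rewrite sub1set.
have xR := bipartition_notin LR xL.
have yL := bipartition_notin (bipartitionC LR) yR.
have xy : x != y by apply: contraNneq xR => ->.
(* The truncated subtraction is exact, as [b] is positive at [x] and [y]. *)
pose b' v := b v - (v \in [set x; y]).
have bE v : b v = (v \in [set x; y]) + b' v.
  rewrite /b' subnKC // !inE.
  by case: eqP => [->|_] //=; case: eqP => [->|].
have wE U : weight b U = (x \in U) + (y \in U) + weight b' U.
  by rewrite -weight_pair // -weightD; apply: eq_weight.
have wL := wE L; have wR := wE R.
rewrite xL (negbTE yL) in wL; rewrite yR (negbTE xR) in wR.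
have [/forall_inP hall'|] :=
    boolP [forall (X : {set T} | X \subset L), weight b' X <= weight b' (neighbours e X)].
  have [s es ds] := IHn b' ltac:(move: ltbn wL; clear; lia) ltac:(move: bLR wL wR; clear; lia) hall'.
  exists ((x, y) :: s); first by rewrite /= exy.
  by move=> v; rewrite bE -ds.
case/forall_inPn => X; rewrite unfold_in => XL tight.
have NXR := bipartition_neighbours LR XL.
have yX : y \notin X by apply: contra yL; apply: (subsetP XL).
have xNX : x \notin neighbours e X by apply: contra xR; apply: (subsetP NXR).
have hX := hall X XL.
have wX := wE X; have wNX := wE (neighbours e X).
rewrite (negbTE yX) in wX; rewrite (negbTE xNX) in wNX.
(* Hall's condition holds for [b] and fails for [b'] at [X]. So [N(X)] must lose the unit at [y]
   while [X] loses nothing; as one unit is enough to break the inequality, it was an equality. *)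
have xX : x \notin X.
  apply/negP => xX; move: wX wNX hX tight; rewrite xX.
  by case: (y \in _); clear; lia.
have yNX : y \in neighbours e X.
  apply: contraR tight => /negbTE yNX; move: wX wNX hX.
  by rewrite (negbTE xX) yNX; clear; lia.
rewrite (negbTE xX) in wX; rewrite yNX in wNX.
have {tight} bX : weight b X = weight b (neighbours e X).
  by move: wX wNX hX tight; clear; lia.
have NX_gt0 : 0 < weight b (neighbours e X) by rewrite wNX.
have bLX : b x <= weight b (L :\: X) by apply: leq_weight; rewrite inE xX.
have IL := weightID b L X; rewrite (setIidPr XL) in IL.
(* Splitting the demand along [V] keeps both parts balanced because [X] is tight. Both are smaller
   on [L]: the part inside [V] misses [x], the part outside misses [b(X) = b(N(X)) > 0]. *)
pose V := X :|: neighbours e X.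
pose b1 v := if v \in V then b v else 0.
pose b2 v := if v \in ~: V then b v else 0.
have VL (U : {set T}) : U \subset L -> U :&: V = U :&: X.
  move=> UL; apply/setP => v; rewrite !inE.
  case: (boolP (v \in U)) => //= /(subsetP UL) vL.
  suff /negbTE : v \notin neighbours e X by rewrite inE => ->; rewrite orbF.
  by apply: contra (bipartition_notin LR vL); apply: (subsetP NXR).
have VR (U : {set T}) : U \subset R -> U :&: V = U :&: neighbours e X.
  move=> UR; apply/setP => v; rewrite in_setI [v \in V]in_setU in_setI.
  case: (boolP (v \in U)) => //= /(subsetP UR) vR.
  suff /negbTE -> : v \notin X by [].
  by apply: contra (bipartition_notin (bipartitionC LR) vR); apply: (subsetP XL).
have w1 U : weight b1 U = weight b (U :&: V) by apply: weight_restrict.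
have w2 U : weight b2 U + weight b (U :&: V) = weight b U.
  by rewrite (weightID b U V) addnC /b2 weight_restrict -setDE.
have [||| s1 es1 ds1] := IHn b1.
- by rewrite w1 VL // (setIidPr XL); move: ltbn IL bLX bx; clear; lia.
- by rewrite !w1 (VL L) // VR // (setIidPr XL) (setIidPr NXR).
(* Hall for [Y :&: X] suffices, since its neighbours lie in both [N(Y)] and [N(X)]. *)
- move=> Y YL; rewrite !w1 (VL Y) // VR ?(bipartition_neighbours LR) //.
  apply: leq_trans (hall _ _) _; first by apply: subset_trans YL; apply: subsetIl.
  by apply: weight_subset; rewrite subsetI !neighboursS ?subsetIl ?subsetIr.
have [||| s2 es2 ds2] := IHn b2.
- have := w2 L; rewrite VL // (setIidPr XL) bX.
  by move: ltbn NX_gt0; clear; lia.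
- have := w2 R; have := w2 L; rewrite (VL L) // (VR R) // (setIidPr XL) (setIidPr NXR).
  by move: bLR bX; clear; lia.
(* Hall for [Y :|: X], with the equal weights of [X] and [N(X)] cancelled, bounds [b(Y :\: X)] by
   [b(N(Y) :\: N(X))]. *)
- move=> Y YL.
  have YXL : Y :|: X \subset L by rewrite subUset YL.
  have := hall _ YXL; rewrite neighboursU.
  have := w2 Y; have := w2 (neighbours e Y).
  rewrite (VL Y) // (VR (neighbours e Y)) ?(bipartition_neighbours LR) //.
  have := weightID b (Y :|: X) X; have := weightID b Y X.
  have := weightID b (neighbours e Y :|: neighbours e X) (neighbours e X).
  have := weightID b (neighbours e Y) (neighbours e X).
  by rewrite !setDUl !setDv !setU0 !(setIC (_ :|: _)) !setKU; move: bX; clear; lia.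
exists (s1 ++ s2); first by rewrite all_cat es1.
move=> v; rewrite /degree count_cat -!/(degree _ _) ds1 ds2 /b1 /b2 in_setC.
by case: (v \in V); rewrite ?addn0.
Qed.

Definition strictly_expanding L :=
  forall X, X != set0 -> X \proper L -> #|X| < #|neighbours e X|.

(** Expansion does not apply to [L] itself, but for [L] minus one vertex its strictness makes up for
    that vertex. *)
Lemma strictly_expanding_leq L R :
  bipartition e L R -> strictly_expanding L -> #|L| <= #|R|.
Proof.
move=> LR expL.
have /set0Pn[x xL] := bipartition_neq0 LR.
rewrite (cardsD1 x) xL.
have [->|X0] := eqVneq (L :\ x) set0.
  by rewrite cards0 card_gt0 (bipartition_neq0 (bipartitionC LR)).
apply: leq_trans (expL _ X0 (properD1 xL)) _.
by rewrite subset_leq_card // (bipartition_neighbours LR) ?subsetDl.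
Qed.

Lemma strictly_expanding_equatable L R w :
  bipartition e L R -> strictly_expanding L -> strictly_expanding R ->
  balanced L R w -> positively_equatable e w.
Proof.
move=> LR expL expR bal.
have cardLR : #|L| = #|R|.
  apply/eqP; rewrite eqn_leq (strictly_expanding_leq LR) //.
  by rewrite (strictly_expanding_leq (bipartitionC LR)).
(* This level dominates each [w v] and also, by balance, the total weight of any subset of [R]. *)
pose c := weight w L.
have wc v : w v <= c.
  have : v \in L :|: R by rewrite (bipartition_setU LR) inE.
  by rewrite inE => /orP[] /(leq_weight w); rewrite -?bal.
pose b v := c - w v.
have bE U : weight b U + weight w U = c * #|U| by apply: weight_sub.
have [|| s es ds] := @weighted_hall L R b LR.
- by have := bE L; have := bE R; rewrite -bal cardLR; lia.
- move=> X XL.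
  have wN : weight w (neighbours e X) <= c.
    by rewrite /c bal weight_subset // (bipartition_neighbours LR).
  have := bE X; have := bE (neighbours e X).
  have [->|X0] := eqVneq X set0; first by rewrite [weight b set0]big_set0.
  (* For proper [X], one extra neighbour contributes a further [c], which absorbs [w(N(X)) <= c]. *)
  have [eXL|XneL] := eqVneq X L; last first.
    have := expL X X0 _; rewrite properEneq XneL => /(_ XL) lt_XN.
    by have := leq_mul (leqnn c) lt_XN; rewrite mulnS; lia.
  (* For [X = L], expansion of [L :\ x] gives only [|L| <= |N(L)|], but now [w(L) = c] on the other
     side offsets [w(N(L))]. If [L] is a single vertex, its demand is zero. *)
  rewrite eXL -/c in wN *.
  have /set0Pn[x xL] := bipartition_neq0 LR.
  have cardL : #|L| = #|L :\ x|.+1 by rewrite (cardsD1 x) xL.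
  have [X1|X1] := eqVneq (L :\ x) set0.
    by rewrite cardL X1 cards0; lia.
  have lt_N := expL _ X1 (properD1 xL).
  have le_N := subset_leq_card (neighboursS e (subsetDl L [set x])).
  have := leq_mul (leqnn c) (leq_trans lt_N le_N).
  by rewrite cardL mulnS; lia.
exists s; split=> // x y.
by rewrite !foldl_positive_step !ds /b !subnKC.
Qed.

Lemma equatable_strictly_expanding L R :
  symmetric e -> irreflexive e -> bipartition e L R ->
  (forall w, balanced L R w -> positively_equatable e w) ->
  strictly_expanding L.
Proof.
move=> e_sym e_irr LR equat X X0 /properP[XL [z zL zX]].
(* The conditional membership lets one test assignment serve whether or not [N(X)] is empty. *)
have [y yR yN] : exists2 y, y \in R & neighbours e X != set0 -> y \in neighbours e X.
  have [N0|/set0Pn[y yN]] := eqVneq (neighbours e X) set0.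
    by have /set0Pn[y yR] := bipartition_neq0 (bipartitionC LR); exists y.
  by exists y => //; apply: (subsetP (bipartition_neighbours LR XL)).
have yL := bipartition_notin (bipartitionC LR) yR.
have zR := bipartition_notin LR zL.
have yz : y != z by apply: contraNneq yL => ->.
pose w v : nat := v \in [set y; z].
have wE U : weight w U = (y \in U) + (z \in U) by apply: weight_pair.
have [|s [es eq_s]] := equat w.
  by rewrite /balanced !wE yR zL (negbTE yL) (negbTE zR).
(* The common final level, read off at [z]; it is positive because [w z = 1]. *)
pose c := w z + degree s z.
have wc U : weight w U + weight (degree s) U = c * #|U|.
  rewrite -weightD -weight_const; apply: eq_weight => v.
  by rewrite /c -!foldl_positive_step.
have c_gt0 : 0 < c by rewrite /c /w !inE eqxx orbT.
have := wc X; have := wc (neighbours e X).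
have := weight_degree_neighbours e_sym e_irr X es.
have yX : y \notin X by apply: contra yL; apply: (subsetP XL).
have zN : z \notin neighbours e X.
  by apply: contra zR; apply: (subsetP (bipartition_neighbours LR XL)).
rewrite !wE (negbTE zX) (negbTE yX) (negbTE zN) => le_d eqN eqX.
rewrite -(ltn_pmul2l c_gt0).
(* If [y] is in [N(X)], its initial unit gives [c|N(X)| >= c|X| + 1]. If [N(X)] is empty, no edge
   meets [X], so [X] would stay at weight 0 below [c]. *)
have [N0|/yN yN1] := eqVneq (neighbours e X) set0; last first.
  by rewrite yN1 in eqN; move: le_d eqN eqX; clear; lia.
have cX_gt0 : 0 < c * #|X| by rewrite muln_gt0 c_gt0 card_gt0.
have cN0 : c * #|neighbours e X| = 0 by rewrite N0 cards0 muln0.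
by move: le_d eqN eqX cX_gt0 cN0; clear; lia.
Qed.

End Bipartite.

Theorem theorem4 (T : finType) (e : rel T) (L R : {set T})
    (e_sym : symmetric e) (e_irr : irreflexive e)
    (LR : bipartition e L R) :
  (forall w : T -> nat, balanced L R w -> positively_equatable e w) <->
  (forall X : {set T}, X != set0 -> X \proper L \/ X \proper R ->
     #|X| < #|neighbours e X|).
Proof.
split=> [equat X X0 [XL|XR] | exp w].
- exact: equatable_strictly_expanding equat _ X0 XL.
- apply: (equatable_strictly_expanding e_sym e_irr (bipartitionC LR)) X0 XR.
  by move=> w bal; apply: equat; rewrite /balanced bal.
- by apply: (strictly_expanding_equatable LR) => X X0 pX;
    apply: exp => //; [left|right].
Qed.
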